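(* Let $\mathcal{C}$ be a causal Markov category. Let $X$ be an object of $\mathcal{C}$, let $J$ be an infinite set, and let $X_J$ be a Kolmogorov power of $X$ by $J$, i.e. a Kolmogorov product of the constant family $(X_i)_{i \in J}$ with $X_i = X$ for all $i$. Let $p : A \to X_J$ be a morphism and let $s : X_J \to T$ be a deterministic morphism such that: (1) $p$ displays the conditional independence $\perp_{i \in J} X_i \,\|\, A$; (2) for every finite permutation $\sigma : J \to J$, we have $\hat{\sigma} p = p$ and $s \hat{\sigma} = s$. Then the composite $s p : A \to T$ is deterministic.
   Context: Coherence isomorphisms of symmetric monoidal categories are suppressed throughout. A symmetric monoidal category $\mathcal{C}$ is semicartesian if its monoidal unit $I$ is terminal; write $\mathrm{del}_X : X \to I$ for the unique morphism. A Markov category is a semicartesian symmetric monoidal category in which every object $X$ is equipped with a distinguished morphism $\mathrm{copy}_X : X \to X \otimes X$ which, together with $\mathrm{del}_X$, makes $X$ into a commutative comonoid, and such that $\mathrm{copy}_{X \otimes Y}$ equals $\mathrm{copy}_X \otimes \mathrm{copy}_Y$ followed by the symmetry exchanging the two middle factors, for all $X, Y$. A morphism $f : X \to Y$ is deterministic if $\mathrm{copy}_Y \circ f = (f \otimes f) \circ \mathrm{copy}_X$. A Markov category is causal if for all morphisms $f : A \to X$, $g : X \to Y$, $h_1, h_2 : Y \to Z$: whenever $(h_1 \otimes \mathrm{id}_Y)\, \mathrm{copy}_Y\, g f = (h_2 \otimes \mathrm{id}_Y)\, \mathrm{copy}_Y\, g f$, then also $$\big([(h_1 \otimes \mathrm{id}_Y)\,\mathrm{copy}_Y\,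 g] \otimes \mathrm{id}_X\big)\, \mathrm{copy}_X\, f = \big([(h_2 \otimes \mathrm{id}_Y)\,\mathrm{copy}_Y\, g] \otimes \mathrm{id}_X\big)\, \mathrm{copy}_X\, f$$ as morphisms $A \to Z \otimes Y \otimes X$. For finite $F \subseteq J$, write $X_F := \bigotimes_{i \in F} X_i$. For finite $F \subseteq F' \subseteq J$, let $\pi_{F',F} : X_{F'} \to X_F$ be the marginalization obtained by applying $\mathrm{del}$ to the factors in $F' \setminus F$. An infinite tensor product of $(X_i)_{i\in J}$ is an object $X_J$ with morphisms $\pi_F : X_J \to X_F$ (finite marginalizations), $F \subseteq J$ finite, which is the limit of the diagram $F \mapsto X_F$ (indexed by the poset of finite subsets of $J$ ordered by reverse inclusion, with transition maps $\pi_{F',F}$), such that this limit is preserved by the functor $- \otimes Y$ for every object $Y$. It is a Kolmogorov product if in addition all $\pi_F$ are deterministic. For a finite family, a morphism $p : A \to \bigotimes_{i \in F} X_i$ displays the conditional independence $\perp_{i \in F} X_i \,\|\, A$ if $p = \big(\bigotimes_{i \in F} p_i\big) \circ \mathrm{copy}_A^{F}$, where $p_i : A \to X_i$ is the marginal of $p$ (apply $\mathrm{del}$ to all other factors) and $\mathrm{copy}_A^F : A \to A^{\otimes F}$ is the iterated copy morphism. For a Kolmogorov product $X_J$, a morphism $p : A \to X_J$ displays $\perp_{i \in J} X_i \,\|\, A$ if for every finite $F \subseteq J$ the morphism $\pi_F \circ p : A \to X_F$ displays $\perp_{i \in F} X_i \,\|\, A$. A finite permutation of $J$ is a bijection $\sigma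 : J \to J$ fixing all but finitely many elements. For $\sigma$ an injection $J \to J$ (in particular a finite permutation), $\hat{\sigma} : X_J \to X_J$ is the unique morphism such that for every finite $F \subseteq J$, $\pi_F \circ \hat{\sigma}$ is the composite of $\pi_{\sigma(F)} : X_J \to X_{\sigma(F)}$ with the isomorphism $X_{\sigma(F)} \cong X_F$ that matches up the factors (all copies of $X$) via the bijection $\sigma|_F : F \to \sigma(F)$. *)

(* Defs.v *)
From mathcomp Require Import all_boot finmap.
From mathcomp Require Import mathcomp_extra boolp classical_sets cardinality.
From Stdlib Require Import Program.Equality.

Set Implicit Arguments.
Unset Strict Implicit.
Unset Printing Implicit Defensive.

Declare Scope markov_scope.
Delimit Scope markov_scope with M.
Local Open Scope fset_scope.
Local Open Scope markov_scope.

Record category := Category {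
  ob :> Type;
  hom : ob -> ob -> Type;
  idm : forall X, hom X X;
  compm : forall X Y Z, hom Y Z -> hom X Y -> hom X Z;
  compmA : forall X Y Z W (h : hom Z W) (g : hom Y Z) (f : hom X Y),
    compm h (compm g f) = compm (compm h g) f;
  comp1m : forall X Y (f : hom X Y), compm (idm Y) f = f;
  compm1 : forall X Y (f : hom X Y), compm f (idm X) = f }.

Arguments hom {c} X Y.
Arguments idm {c} X.
Arguments compm {c X Y Z} g f.
Arguments compmA {c X Y Z W} h g f.
Arguments comp1m {c X Y} f.
Arguments compm1 {c X Y} f.
Notation "g ∘ f" := (compm g f) (at level 40, left associativity) : markov_scope.

(* Coherence isomorphisms are explicit: [assoc], [lunit], [runit], [braid],
   with [associ], [luniti], [runiti] the inverses of the first three. *)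
Record symMonCategory := SymMonCategory {
  smc_cat :> category;
  unit_ob : smc_cat;
  tensor : smc_cat -> smc_cat -> smc_cat;
  tensorm : forall X Y X' Y' : smc_cat, hom X Y -> hom X' Y' ->
    hom (tensor X X') (tensor Y Y');
  assoc : forall X Y Z, hom (tensor (tensor X Y) Z) (tensor X (tensor Y Z));
  associ : forall X Y Z, hom (tensor X (tensor Y Z)) (tensor (tensor X Y) Z);
  lunit : forall X, hom (tensor unit_ob X) X;
  luniti : forall X, hom X (tensor unit_ob X);
  runit : forall X, hom (tensor X unit_ob) X;
  runiti : forall X, hom X (tensor X unit_ob);
  braid : forall X Y, hom (tensor X Y) (tensor Y X);
  tensor1 : forall X Y, tensorm (idm X) (idm Y) = idm (tensor X Y);
  tensorD : forall X Y Z X' Y' Z' (g : hom Y Z) (f : hom X Y)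
    (g' : hom Y' Z') (f' : hom X' Y'),
    tensorm (g ∘ f) (g' ∘ f') = tensorm g g' ∘ tensorm f f';
  assocK : forall X Y Z, associ X Y Z ∘ assoc X Y Z = idm _;
  associK : forall X Y Z, assoc X Y Z ∘ associ X Y Z = idm _;
  lunitK : forall X, luniti X ∘ lunit X = idm _;
  lunitiK : forall X, lunit X ∘ luniti X = idm _;
  runitK : forall X, runiti X ∘ runit X = idm _;
  runitiK : forall X, runit X ∘ runiti X = idm _;
  braidK : forall X Y, braid Y X ∘ braid X Y = idm _;
  assoc_nat : forall X Y Z X' Y' Z' (f : hom X X') (g : hom Y Y') (h : hom Z Z'),
    assoc X' Y' Z' ∘ tensorm (tensorm f g) h
    = tensorm f (tensorm g h) ∘ assoc X Y Z;
  lunit_nat : forall X Y (f : hom X Y),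
    lunit Y ∘ tensorm (idm unit_ob) f = f ∘ lunit X;
  runit_nat : forall X Y (f : hom X Y),
    runit Y ∘ tensorm f (idm unit_ob) = f ∘ runit X;
  braid_nat : forall X Y X' Y' (f : hom X X') (g : hom Y Y'),
    braid X' Y' ∘ tensorm f g = tensorm g f ∘ braid X Y;
  pentagon : forall X Y Z W,
    tensorm (idm X) (assoc Y Z W) ∘ assoc X (tensor Y Z) W
      ∘ tensorm (assoc X Y Z) (idm W)
    = assoc X Y (tensor Z W) ∘ assoc (tensor X Y) Z W;
  triangle : forall X Y,
    tensorm (idm X) (lunit Y) ∘ assoc X unit_ob Y = tensorm (runit X) (idm Y);
  hexagon : forall X Y Z,
    assoc Y Z X ∘ braid X (tensor Y Z) ∘ assoc X Y Z
    = tensorm (idm Y) (braid X Z) ∘ assoc Y X Z ∘ tensorm (braid X Y) (idm Z) }.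

Arguments unit_ob {s}.
Arguments tensor {s} X Y.
Arguments tensorm {s X Y X' Y'} f g.
Arguments assoc {s} X Y Z.
Arguments associ {s} X Y Z.
Arguments lunit {s} X.
Arguments luniti {s} X.
Arguments runit {s} X.
Arguments runiti {s} X.
Arguments braid {s} X Y.
Notation "X ⊗ Y" := (tensor X Y) (at level 35, right associativity) : markov_scope.
Notation "f ⊗₁ g" := (tensorm f g) (at level 35, right associativity) : markov_scope.

Definition middle_swap (C : symMonCategory) (X X' Y Y' : C) :
    hom ((X ⊗ X') ⊗ (Y ⊗ Y')) ((X ⊗ Y) ⊗ (X' ⊗ Y')) :=
  associ X Y (X' ⊗ Y') ∘ (idm X ⊗₁ assoc Y X' Y')
  ∘ (idm X ⊗₁ (braid X' Y ⊗₁ idm Y')) ∘ (idm X ⊗₁ associ X' Y Y')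
  ∘ assoc X X' (Y ⊗ Y').

Record markovCategory := MarkovCategory {
  markov_smc :> symMonCategory;
  del : forall X : markov_smc, hom X unit_ob;
  del_unique : forall (X : markov_smc) (f : hom X unit_ob), f = del X;
  copy : forall X : markov_smc, hom X (X ⊗ X);
  copyA : forall X, assoc X X X ∘ (copy X ⊗₁ idm X) ∘ copy X
                    = (idm X ⊗₁ copy X) ∘ copy X;
  copyC : forall X, braid X X ∘ copy X = copy X;
  copy_dell : forall X, lunit X ∘ (del X ⊗₁ idm X) ∘ copy X = idm X;
  copy_delr : forall X, runit X ∘ (idm X ⊗₁ del X) ∘ copy X = idm X;
  copy_tensor : forall X Y,
    copy (X ⊗ Y) = middle_swap X X Y Y ∘ (copy X ⊗₁ copy Y) }.

Arguments del {m} X.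
Arguments copy {m} X.

Definition deterministic (C : markovCategory) (X Y : C) (f : hom X Y) : Prop :=
  copy Y ∘ f = (f ⊗₁ f) ∘ copy X.

Definition causal (C : markovCategory) : Prop :=
  forall (A X Y Z : C) (f : hom A X) (g : hom X Y) (h1 h2 : hom Y Z),
    (h1 ⊗₁ idm Y) ∘ copy Y ∘ (g ∘ f) = (h2 ⊗₁ idm Y) ∘ copy Y ∘ (g ∘ f) ->
    (((h1 ⊗₁ idm Y) ∘ copy Y ∘ g) ⊗₁ idm X) ∘ copy X ∘ f
    = (((h2 ⊗₁ idm Y) ∘ copy Y ∘ g) ⊗₁ idm X) ∘ copy X ∘ f.

(* [tens X [:: i1; ...; in]] is X i1 ⊗ (X i2 ⊗ (... ⊗ (X in ⊗ I))). *)
Fixpoint tens (C : symMonCategory) K (X : K -> C) (s : seq K) : C :=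
  if s is i :: s' then X i ⊗ tens X s' else unit_ob.

Fixpoint tens_mor (C : symMonCategory) K (X Y : K -> C)
    (p : forall i, hom (X i) (Y i)) (s : seq K) : hom (tens X s) (tens Y s) :=
  if s is i :: s' then p i ⊗₁ tens_mor p s' else idm unit_ob.

Fixpoint iter_copy (C : markovCategory) K (A : C) (s : seq K) :
    hom A (tens (fun _ : K => A) s) :=
  if s is i :: s' then (idm A ⊗₁ iter_copy A s') ∘ copy A else del A.

(* [pick j s r]: an occurrence of [j] in [s], whose removal leaves [r]. *)
Inductive pick K (j : K) : seq K -> seq K -> Type :=
| pick_here s : pick j (j :: s) s
| pick_there k s r of pick j s r : pick j (k :: s) (k :: r).

Definition swap_head (C : symMonCategory) (X Y Z : C) :
    hom (X ⊗ (Y ⊗ Z)) (Y ⊗ (X ⊗ Z)) :=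
  assoc Y X Z ∘ (braid X Y ⊗₁ idm Z) ∘ associ X Y Z.

(* The symmetry moving the picked factor to the front. *)
Fixpoint pick_mor (C : symMonCategory) K (X : K -> C) (j : K) (s r : seq K)
    (w : pick j s r) : hom (tens X s) (X j ⊗ tens X r) :=
  match w in pick _ s r return hom (tens X s) (X j ⊗ tens X r) with
  | pick_here s => idm _
  | pick_there k s r w' => swap_head (X k) (X j) (tens X r) ∘ (idm (X k) ⊗₁ pick_mor X w')
  end.

(* [select f t s]: the images under [f] of the entries of [t] are matched with
   distinct positions of [s]; the remaining positions of [s] are discarded. *)
Inductive select K K' (f : K -> K') : seq K -> seq K' -> Type :=
| select_nil s : select f [::] s
| select_cons i t s r of pick (f i) s r & select f t r : select f (i :: t) s.

(* The morphism that permutes the selected factors into place and applies [del]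
   to the discarded ones. *)
Fixpoint select_mor (C : markovCategory) K K' (f : K -> K') (X : K' -> C)
    (t : seq K) (s : seq K') (w : select f t s) :
    hom (tens X s) (tens (X \o f) t) :=
  match w in select _ t s return hom (tens X s) (tens (X \o f) t) with
  | select_nil s => del _
  | select_cons i t s r v w' => (idm (X (f i)) ⊗₁ select_mor X w') ∘ pick_mor X v
  end.

Lemma pick_rem (K : eqType) (j : K) (s : seq K) : j \in s -> pick j s (rem j s).
Proof.
elim: s => [//|k s IHs]; rewrite inE eq_sym /=.
case: eqP => [-> _|_ /= js]; first exact: pick_here.
exact/pick_there/IHs.
Defined.

Lemma select_subset (K K' : eqType) (f : K -> K') (t : seq K) (s : seq K') :
  injective f -> uniq t -> {subset map f t <= s} -> select f t s.
Proof.
move=> f_inj; elim: t s => [|i t IHt] s /=; first by move=> *; apply: select_nil.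
move=> /andP[it t_uniq] fts.
apply: (select_cons (pick_rem (fts _ (mem_head _ _)))); apply: IHt => // j fj.
have := fts j; rewrite inE fj orbT => /(_ isT) js.
have [ij|ij] := eqVneq j (f i); last by rewrite (rem_mem _ js).
by move: fj; rewrite ij mem_map // (negbTE it).
Defined.

Definition select_enum (K K' : finType) (f : K -> K') (f_inj : injective f) :
    select f (enum K) (enum K') :=
  select_subset f_inj (enum_uniq K) (fun i _ => mem_enum K' i).

Definition bigtensor (C : symMonCategory) (K : finType) (X : K -> C) : C :=
  tens X (enum K).

(* For injective [f], keeps the factors indexed by the image of [f], relabelled
   along [f], and applies [del] to the others: a marginalization when [f] is an
   inclusion, a permutation isomorphism when [f] is bijective. *)
Definition reindex (C : markovCategory) (K K' : finType) (X : K' -> C)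
    (f : K -> K') (f_inj : injective f) :
    hom (bigtensor X) (bigtensor (X \o f)) :=
  select_mor X (select_enum f_inj).

Definition marg1 (C : markovCategory) (K : finType) (X : K -> C) (i : K) :
    hom (bigtensor X) (X i) :=
  runit (X i) ∘ (idm (X i) ⊗₁ del _) ∘ pick_mor X (pick_rem (mem_enum K i)).

Definition displays_indep_fin (C : markovCategory) (K : finType) (X : K -> C)
    (A : C) (p : hom A (bigtensor X)) : Prop :=
  p = tens_mor (fun i => marg1 X i ∘ p) (enum K) ∘ iter_copy A (enum K).

Definition fin_tensor (C : symMonCategory) (J : choiceType) (X : J -> C)
    (F : {fset J}) : C :=
  bigtensor (fun i : F => X (val i)).

Definition marg (C : markovCategory) (J : choiceType) (X : J -> C)
    (F F' : {fset J}) (sFF' : F `<=` F') :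
    hom (fin_tensor X F') (fin_tensor X F) :=
  reindex (fun i : F' => X (val i)) (@fincl_inj _ _ _ sFF').

Definition is_cone (C : category) (J : choiceType) (D : {fset J} -> C)
    (d : forall F F' : {fset J}, F `<=` F' -> hom (D F') (D F))
    (L : C) (q : forall F, hom L (D F)) : Prop :=
  forall (F F' : {fset J}) (sFF' : F `<=` F'), d F F' sFF' ∘ q F' = q F.

Definition is_limit (C : category) (J : choiceType) (D : {fset J} -> C)
    (d : forall F F' : {fset J}, F `<=` F' -> hom (D F') (D F))
    (L : C) (q : forall F, hom L (D F)) : Prop :=
  is_cone d q /\
  forall (B : C) (r : forall F, hom B (D F)), is_cone d r ->
    exists! h : hom B L, forall F, q F ∘ h = r F.

Record infTensor (C : markovCategory) (J : choiceType) (X : J -> C) := InfTensor {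
  inf_ob :> C;
  fin_marg : forall F : {fset J}, hom inf_ob (fin_tensor X F);
  fin_marg_limit : is_limit (@marg C J X) fin_marg;
  fin_marg_limit_tensor : forall Y : C,
    is_limit (D := fun F => fin_tensor X F ⊗ Y)
      (fun F F' sFF' => @marg C J X F F' sFF' ⊗₁ idm Y)
      (fun F => fin_marg F ⊗₁ idm Y) }.

Arguments fin_marg {C J X i} F.

Record kolmogorovProduct (C : markovCategory) (J : choiceType) (X : J -> C) :=
  KolmogorovProduct {
    kol_inf :> infTensor X;
    kol_det : forall F : {fset J}, deterministic (@fin_marg C J X kol_inf F) }.

Definition displays_indep (C : markovCategory) (J : choiceType) (X : J -> C)
    (XJ : kolmogorovProduct X) (A : C) (p : hom A XJ) : Prop :=
  forall F : {fset J}, displays_indep_fin (fin_marg F ∘ p).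

Definition finite_permutation (J : Type) (sigma : J -> J) : Prop :=
  bijective sigma /\ finite_set [set i | sigma i <> i]%classic.

Lemma finite_permutation_inj (J : Type) (sigma : J -> J) :
  finite_permutation sigma -> injective sigma.
Proof. by case=> /bij_inj. Qed.

Definition fin_image (J : choiceType) (sigma : J -> J) (F : {fset J}) (i : F) :
    (sigma @` F : {fset J}) :=
  [` in_imfset imfset_key sigma (valP i)].

Lemma fin_image_inj (J : choiceType) (sigma : J -> J) (F : {fset J}) :
  injective sigma -> injective (@fin_image J sigma F).
Proof. by move=> sigma_inj i j /(congr1 val) /= /sigma_inj /val_inj. Qed.

(* The isomorphism X_{σ(F)} -> X_F matching up the factors via σ. *)
Definition relabel (C : markovCategory) (X : C) (J : choiceType)
    (sigma : J -> J) (sigma_inj : injective sigma) (F : {fset J}) :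
    hom (fin_tensor (fun _ : J => X) (sigma @` F)) (fin_tensor (fun _ : J => X) F) :=
  reindex (fun _ => X) (@fin_image_inj J sigma F sigma_inj).

(* Composites of reindexings are reindexings; hence the universal property of an
   infinite tensor product applies to the cone defining [hat] below. *)
Lemma idt_comp (C : symMonCategory) (X Y Z W : C) (g : hom Y Z) (f : hom X Y) :
  idm W ⊗₁ (g ∘ f) = (idm W ⊗₁ g) ∘ (idm W ⊗₁ f).
Proof. by rewrite -tensorD comp1m. Qed.

Lemma compt_id (C : symMonCategory) (X Y Z W : C) (g : hom Y Z) (f : hom X Y) :
  (g ∘ f) ⊗₁ idm W = (g ⊗₁ idm W) ∘ (f ⊗₁ idm W).
Proof. by rewrite -tensorD comp1m. Qed.

Lemma associ_nat (C : symMonCategory) (X Y Z X' Y' Z' : C)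
    (f : hom X X') (g : hom Y Y') (h : hom Z Z') :
  associ X' Y' Z' ∘ (f ⊗₁ (g ⊗₁ h)) = ((f ⊗₁ g) ⊗₁ h) ∘ associ X Y Z.
Proof.
by rewrite -[LHS]compm1 -associK -compmA (compmA _ (assoc _ _ _)) -assoc_nat 2!compmA
  assocK comp1m.
Qed.

Lemma swap_head_nat (C : symMonCategory) (X Y Z X' Y' Z' : C)
    (f : hom X X') (g : hom Y Y') (h : hom Z Z') :
  swap_head X' Y' Z' ∘ (f ⊗₁ (g ⊗₁ h)) = (g ⊗₁ (f ⊗₁ h)) ∘ swap_head X Y Z.
Proof.
rewrite /swap_head -compmA associ_nat compmA -(compmA (assoc _ _ _)) -tensorD.
by rewrite braid_nat comp1m -{1}[h]compm1 tensorD !compmA assoc_nat.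
Qed.

Lemma swap_headK (C : symMonCategory) (X Y Z : C) :
  swap_head Y X Z ∘ swap_head X Y Z = idm _.
Proof.
rewrite /swap_head !compmA -(compmA _ (associ _ _ _) (assoc _ _ _)) assocK compm1.
by rewrite -(compmA _ _ (braid X Y ⊗₁ _)) -compt_id braidK tensor1 compm1 associK.
Qed.

Lemma swap_head_hexagon (C : symMonCategory) (X Y Z R : C) :
  assoc Y Z (X ⊗ R) ∘ swap_head X (Y ⊗ Z) R =
  (idm Y ⊗₁ swap_head X Z R) ∘ swap_head X Y (Z ⊗ R) ∘ (idm X ⊗₁ assoc Y Z R).
Proof.
have hexY : assoc Y Z X ∘ braid X (Y ⊗ Z) =
    (idm Y ⊗₁ braid X Z) ∘ assoc Y X Z ∘ (braid X Y ⊗₁ idm Z) ∘ associ X Y Z.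
  by rewrite -hexagon -compmA associK compm1.
have pY : assoc Y (X ⊗ Z) R ∘ (assoc Y X Z ⊗₁ idm R) =
    (idm Y ⊗₁ associ X Z R) ∘ assoc Y X (Z ⊗ R) ∘ assoc (Y ⊗ X) Z R.
  by rewrite -compmA -pentagon !compmA -tensorD compm1 assocK tensor1 comp1m.
have pX : assoc (X ⊗ Y) Z R ∘ (associ X Y Z ⊗₁ idm R) ∘ associ X (Y ⊗ Z) R =
    associ X Y (Z ⊗ R) ∘ (idm X ⊗₁ assoc Y Z R).
  rewrite -[LHS]comp1m -(assocK X Y (Z ⊗ R)) -!compmA; congr (_ ∘ _).
  rewrite !compmA -pentagon -(compmA _ (assoc X Y Z ⊗₁ idm R)) -compt_id associK tensor1.
  by rewrite compm1 -compmA associK compm1.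
rewrite {1}/swap_head !compmA -pentagon -(compmA _ (_ ⊗₁ idm R) (_ ⊗₁ idm R)).
rewrite -compt_id hexY !compt_id !compmA -(compmA _ (assoc Y (Z ⊗ X) R)).
rewrite assoc_nat !compmA -(compmA _ (assoc Y (X ⊗ Z) R)) pY !compmA.
rewrite -(compmA _ (assoc (Y ⊗ X) Z R)) assoc_nat tensor1 !compmA.
rewrite -(compmA _ (associ X Y Z ⊗₁ _)) -(compmA _ (assoc (X ⊗ Y) Z R)).
by rewrite [assoc (X ⊗ Y) Z R ∘ (_ ∘ _)]compmA pX /swap_head !idt_comp !compmA.
Qed.

Lemma swap_headE (C : symMonCategory) (X Y Z : C) : swap_head X Y Z =
  assoc Y X Z ∘ (braid X Y ⊗₁ idm Z) ∘ associ X Y Z.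
Proof. by []. Qed.


Lemma swap_head_braid (C : symMonCategory) (A B K R : C) :
  swap_head A B (K ⊗ R) ∘ (idm A ⊗₁ swap_head K B R) ∘ swap_head K A (B ⊗ R) =
  (idm B ⊗₁ swap_head K A R) ∘ swap_head K B (A ⊗ R) ∘ (idm K ⊗₁ swap_head A B R).
Proof.
move: (@swap_head_nat C) (@swap_head_hexagon C) (@swap_headE C).
move: (@swap_head C) => sw sw_nat sw_hexagon swE.
have hex X Y : (idm X ⊗₁ sw K Y R) ∘ sw K X (Y ⊗ R) =
    assoc X Y (K ⊗ R) ∘ sw K (X ⊗ Y) R ∘ (idm K ⊗₁ associ X Y R).
  by rewrite sw_hexagon -[RHS]compmA -idt_comp associK tensor1 compm1.
rewrite hex -[LHS]compmA hex !compmA (swE A B R) !idt_comp !compmA.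
rewrite -(compmA _ (_ ⊗₁ associ B A R)) -idt_comp assocK tensor1 compm1.
rewrite -(compmA _ (sw K (B ⊗ A) R)) sw_nat tensor1 !compmA.
by rewrite (swE A B) -(compmA _ (associ A B (K ⊗ R))) assocK compm1.
Qed.

Lemma pick_cons_ind K (j : K) (P : forall k s r, pick j (k :: s) r -> Prop) :
  (forall s, P j s s (pick_here j s)) ->
  (forall k s r w, P k s (k :: r) (pick_there k w)) ->
  forall k s r w, P k s r w.
Proof.
move=> H1 H2 k s r w.
exact: (match w as w in pick _ s0 r0 return
  match s0 return pick j s0 r0 -> Prop with
  | [::] => fun _ => True | k' :: s' => fun w' => P k' s' r0 w' end w with
  pick_here s => H1 s | pick_there k s r w' => H2 k s r w' end).
Qed.

Lemma pick_swap (C : symMonCategory) K (X : K -> C) (a b : K) s s1 s2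
    (p : pick a s s1) (q : pick b s1 s2) :
  exists s1' (q' : pick b s s1') (p' : pick a s1' s2),
  swap_head (X a) (X b) (tens X s2) ∘ (idm (X a) ⊗₁ pick_mor X q) ∘ pick_mor X p =
  (idm (X b) ⊗₁ pick_mor X p') ∘ pick_mor X q'.
Proof.
elim: p s2 q => {s s1} [s|k s r p IHp] s2 q.
  by exists (a :: s2), (pick_there a q), (pick_here a s2); rewrite /= tensor1 compm1 comp1m.
elim/pick_cons_ind: k r s2 / q p IHp => [r|k r r2 q] p IHp.
  exists s, (pick_here b s), p => /=.
  by rewrite tensor1 !compm1 compmA swap_headK comp1m.
have [s1' [q' [p' e]]] := IHp _ q.
exists (k :: s1'), (pick_there k q'), (pick_there k p') => /=.
move: (@swap_head_nat C) (@swap_head_braid C) e; move: (@swap_head C).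
move=> sw sw_nat sw_braid e; rewrite !idt_comp !compmA.
rewrite -(compmA _ (_ ⊗₁ (_ ⊗₁ _)) (sw _ _ _)) -sw_nat compmA sw_braid.
rewrite -2!compmA -2!idt_comp compmA e idt_comp compmA.
by rewrite -(compmA _ _ (_ ⊗₁ (_ ⊗₁ _))) sw_nat !compmA.
Qed.

Lemma select_cons_ind K K' (f : K -> K')
    (P : forall i t s, select f (i :: t) s -> Prop) :
  (forall i t s r (v : pick (f i) s r) w, P i t s (select_cons v w)) ->
  forall i t s w, P i t s w.
Proof.
move=> H i t s w.
exact: (match w as w in select _ t0 s0 return
  match t0 return select f t0 s0 -> Prop with
  | [::] => fun _ => True | k' :: s' => fun w' => P k' s' s0 w' end w with
  select_nil s => I | select_cons i t s r v w' => H i t s r v w' end).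
Qed.

Lemma pick_select (C : markovCategory) K K' (f : K -> K') (X : K' -> C)
    j t r s (w : select f t s) (v : pick j t r) :
  exists s' (v' : pick (f j) s s') (w' : select f r s'),
  pick_mor (X \o f) v ∘ select_mor X w =
  (idm (X (f j)) ⊗₁ select_mor X w') ∘ pick_mor X v'.
Proof.
elim: v s w => {t r} [t|k t r v IHv] s w.
  elim/select_cons_ind: j t s / w => i t s r v w.
  by exists r, v, w; rewrite /= comp1m.
elim/select_cons_ind: k t s / w r v IHv => i t s r v w r' u IH.
have [s' [v1 [w1 e1]]] := IH _ w.
have [s1 [v2 [v3 e2]]] := pick_swap X v v1.
exists s1, v2, (select_cons v3 w1) => /=.
rewrite -compmA (compmA (_ ⊗₁ _) (_ ⊗₁ _)) -idt_comp e1 !idt_comp !compmA.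
by rewrite swap_head_nat -!compmA -e2 !compmA.
Qed.

Lemma select_comp (C : markovCategory) K0 K K' (g : K0 -> K) (f : K -> K')
    (X : K' -> C) u t s (w2 : select g u t) (w1 : select f t s) :
  exists w3 : select (f \o g) u s,
  select_mor (X \o f) w2 ∘ select_mor X w1 = select_mor X w3.
Proof.
elim: w2 s w1 => {u t} [t|i u t r v w2 IH] s w1.
  by exists (select_nil _ s); rewrite /=; apply: del_unique.
have [s' [v' [w' e]]] := pick_select X w1 v.
have [w3 e3] := IH _ w'.
exists (select_cons (v' : pick ((f \o g) i) _ _) w3) => /=.
by rewrite -compmA e compmA -e3 -idt_comp.
Qed.

Lemma pick_subset (K : eqType) (j : K) s r : pick j s r -> {subset r <= s}.
Proof.
elim=> {s r} [s|k s r _ IH] x; rewrite !inE; first by move=> ->; rewrite orbT.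
by case/orP => [->//|/IH ->]; rewrite orbT.
Qed.

Lemma pick_in (K : eqType) (j : K) s r : pick j s r -> j \in s.
Proof. by elim=> {s r} [s|k s r _ IH]; rewrite inE ?eqxx // IH orbT. Qed.

Lemma pick_uniq (K : eqType) (j : K) s r : pick j s r -> uniq s -> uniq r.
Proof.
elim=> {s r} [s|k s r p IH] /=; first by case/andP.
by case/andP=> ks us; rewrite IH // andbT; apply: contra ks; apply: (pick_subset p).
Qed.

Lemma pick_inj (K : eqType) (j : K) s r (w : pick j s r) (us : uniq s) r' (w' : pick j s r') :
  existT (pick j s) r w = existT (pick j s) r' w'.
Proof.
elim: w us r' w' => {s r} [s|k s r w IH] us r' w'.
  dependent destruction w' => //.
  by move: us; rewrite /= (pick_in w').
dependent destruction w'; first by move: us; rewrite /= (pick_in w).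
have /andP[_ us'] := us.
by have := IH us' _ w' => e; dependent destruction e.
Qed.

Lemma select_inj K (K' : eqType) (f : K -> K') t s (w w' : select f t s) : uniq s -> w = w'.
Proof.
elim: w w' => {t s} [s|i t s r v w IH] w' us; dependent destruction w' => //.
have e := pick_inj v us p; dependent destruction e.
by rewrite (IH w') //; apply: (pick_uniq p).
Qed.

Lemma reindex_const_comp (C : markovCategory) (X : C) (K0 K K' : finType)
    (g : K0 -> K) (f : K -> K') (h : K0 -> K') (g_inj : injective g)
    (f_inj : injective f) (h_inj : injective h) :
  f \o g =1 h ->
  reindex (fun _ : K => X) g_inj ∘ reindex (fun _ : K' => X) f_inj
  = reindex (fun _ : K' => X) h_inj.
Proof.
move=> /funext e; subst h.
have [w e] := select_comp (fun _ : K' => X) (select_enum g_inj) (select_enum f_inj).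
by rewrite /reindex e (select_inj w (select_enum h_inj)) // enum_uniq.
Qed.

Lemma relabel_cone (C : markovCategory) (X : C) (J : choiceType)
    (XJ : infTensor (fun _ : J => X)) (sigma : J -> J)
    (sigma_inj : injective sigma) :
  is_cone (@marg C J (fun _ => X))
    (fun F => relabel X sigma_inj F ∘ @fin_marg _ _ _ XJ (sigma @` F)).
Proof.
move=> F F' sFF'; have sF : sigma @` F `<=` sigma @` F'.
  by apply/fsubsetP => _ /imfsetP[x xF ->]; apply/in_imfset/(fsubsetP sFF').
have h_inj : injective (fincl sF \o @fin_image J sigma F).
  exact: inj_comp (@fincl_inj _ _ _ sF) (fin_image_inj sigma_inj).
rewrite -(proj1 (fin_marg_limit XJ) _ _ sF) !compmA; congr (_ ∘ _).
rewrite /relabel /marg (reindex_const_comp X _ _ h_inj).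
  by rewrite (reindex_const_comp X _ _ h_inj).
by move=> i; apply: val_inj.
Qed.

Lemma hat_subproof (C : markovCategory) (X : C) (J : choiceType)
    (XJ : infTensor (fun _ : J => X)) (sigma : J -> J)
    (sigma_inj : injective sigma) :
  exists! h : hom XJ XJ, forall F : {fset J},
    fin_marg F ∘ h = relabel X sigma_inj F ∘ fin_marg (sigma @` F).
Proof. exact: (proj2 (fin_marg_limit XJ) _ _ (relabel_cone XJ sigma_inj)). Qed.

Definition hat (C : markovCategory) (X : C) (J : choiceType)
    (XJ : infTensor (fun _ : J => X)) (sigma : J -> J)
    (sigma_inj : injective sigma) : hom XJ XJ :=
  sval (cid (hat_subproof XJ sigma_inj)).

Lemma hatE (C : markovCategory) (X : C) (J : choiceType)
    (XJ : infTensor (fun _ : J => X)) (sigma : J -> J)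
    (sigma_inj : injective sigma) (F : {fset J}) :
  fin_marg F ∘ hat XJ sigma_inj = relabel X sigma_inj F ∘ fin_marg (sigma @` F).
Proof. by rewrite /hat; case: cid => h [/= hP _]; apply: hP. Qed.

Definition kolmogorovPower (C : markovCategory) (X : C) (J : choiceType) :=
  kolmogorovProduct (fun _ : J => X).

(* Main.v *)
From HB Require Import structures.
Require Import Defs.
From mathcomp Require Import all_boot finmap.
From mathcomp Require Import mathcomp_extra boolp classical_sets cardinality.
From mathcomp Require Import functions.
From Stdlib Require Import Program.Equality.

(** The proof transports the classical argument for the Hewitt-Savage zero-one
    law: an exchangeable event is independent of every finite set of
    coordinates, hence of itself.  Write ⟨f, g⟩ for (f ⊗ g) ∘ copy.

    A finite permutation τ leaves p and s invariant, and τ^ is deterministic, so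
    ⟨τ^, s⟩ p = ⟨id, s⟩ p.  On finitely many coordinates an injection σ of J
    cannot be told from a finite permutation, and X_J ⊗ T is a limit over the
    finite coordinate sets, so the same equation holds for every injection σ
    ([hat_exchangeable]).  Applying s gives ⟨s σ^, s⟩ p = copy s p: the pair
    (s σ^, s) is concentrated on the diagonal.  Causality turns this into
    almost sure equality, ⟨s σ^, id⟩ p = ⟨s, id⟩ p ([causal_ae_eq]).

    Given a finite F, choose σ with image disjoint from F, which exists because
    J is infinite ([injection_avoiding]).  Then s σ^ depends only on coordinates
    outside F, so it is independent of X_F ([fin_marg_hat_indep]); since s is
    almost surely equal to s σ^, also s is independent of X_F.  By the universal
    property of X_J ⊗ T, s is independent of X_J, that is,
    ⟨id, s⟩ p = ⟨p, s p⟩, and applying s once more yields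
    copy s p = ⟨s, s⟩ p = ⟨s p, s p⟩, which is determinism of s p.

    The structural isomorphisms being explicit, most of the work consists in
    showing that the deterministic morphisms behave as in a cartesian category
    with pairing ⟨f, g⟩ ([pair_proj], [det_pair], [det_projl]); equations
    between composites of structural maps are then checked on pairs.  With this,
    independence of all coordinates in a finite set gives independence of two
    disjoint groups of them ([select_pair_prodm]). *)

Set Implicit Arguments.
Unset Strict Implicit.
Unset Printing Implicit Defensive.

Local Open Scope markov_scope.

(** * Pairing, and the cartesian structure of deterministic morphisms *)

(** Locked, so that rewriting with associativity of composition does not see
    the composite in its body. *)
HB.lock Definition pairm (C : markovCategory) (A X Y : C) (f : hom A X) (g : hom A Y) :
    hom A (X ⊗ Y) :=
  (f ⊗₁ g) ∘ copy A.

Canonical pairm_unlockable := Unlockable pairm.unlock.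

Local Notation "⟨ f , g ⟩" := (pairm f g) (at level 0, f, g at level 99).

Lemma pairE (C : markovCategory) (A X Y : C) (f : hom A X) (g : hom A Y) :
  ⟨f, g⟩ = (f ⊗₁ g) ∘ copy A.
Proof. by rewrite unlock. Qed.

Definition projl (C : markovCategory) (X Y : C) : hom (X ⊗ Y) X :=
  runit X ∘ (idm X ⊗₁ del Y).

Definition projr (C : markovCategory) (X Y : C) : hom (X ⊗ Y) Y :=
  lunit Y ∘ (del X ⊗₁ idm Y).

Arguments projl {C} X Y.
Arguments projr {C} X Y.

Lemma tensor_pair (C : markovCategory) (A X Y X' Y' : C) (f : hom A X)
    (g : hom A Y) (a : hom X X') (b : hom Y Y') :
  (a ⊗₁ b) ∘ ⟨f, g⟩ = ⟨a ∘ f, b ∘ g⟩.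
Proof. by rewrite !pairE compmA -tensorD. Qed.

(** Determinism is what makes pairing natural in the source. *)
Lemma pair_comp_det (C : markovCategory) (A B X Y : C) (f : hom A X)
    (g : hom A Y) (d : hom B A) :
  deterministic d -> ⟨f, g⟩ ∘ d = ⟨f ∘ d, g ∘ d⟩.
Proof. by move=> d_det; rewrite !pairE -compmA d_det compmA -tensorD. Qed.

Lemma braid_pair (C : markovCategory) (A X Y : C) (f : hom A X) (g : hom A Y) :
  braid X Y ∘ ⟨f, g⟩ = ⟨g, f⟩.
Proof. by rewrite !pairE compmA braid_nat -compmA copyC. Qed.

Lemma assoc_pair (C : markovCategory) (A X Y Z : C) (f : hom A X) (g : hom A Y)
    (h : hom A Z) :
  assoc X Y Z ∘ ⟨⟨f, g⟩, h⟩ = ⟨f, ⟨g, h⟩⟩.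
Proof.
rewrite !pairE -{1}[h]compm1 tensorD !compmA assoc_nat -!compmA (compmA (assoc _ _ _)).
by rewrite copyA compmA -tensorD compm1.
Qed.

Lemma associ_pair (C : markovCategory) (A X Y Z : C) (f : hom A X) (g : hom A Y)
    (h : hom A Z) :
  associ X Y Z ∘ ⟨f, ⟨g, h⟩⟩ = ⟨⟨f, g⟩, h⟩.
Proof. by rewrite -assoc_pair compmA assocK comp1m. Qed.

Lemma projl_tensor (C : markovCategory) (X Y X' Y' : C) (f : hom X X')
    (g : hom Y Y') :
  projl X' Y' ∘ (f ⊗₁ g) = f ∘ projl X Y.
Proof.
rewrite /projl -compmA -tensorD (del_unique (del Y' ∘ g)) comp1m.
by rewrite compmA -runit_nat -compmA -tensorD compm1 comp1m.
Qed.

Lemma projr_tensor (C : markovCategory) (X Y X' Y' : C) (f : hom X X')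
    (g : hom Y Y') :
  projr X' Y' ∘ (f ⊗₁ g) = g ∘ projr X Y.
Proof.
rewrite /projr -compmA -tensorD (del_unique (del X' ∘ f)) comp1m.
by rewrite compmA -lunit_nat -compmA -tensorD compm1 comp1m.
Qed.

Lemma projl_pair (C : markovCategory) (A X Y : C) (f : hom A X) (g : hom A Y) :
  projl X Y ∘ ⟨f, g⟩ = f.
Proof. by rewrite !pairE compmA projl_tensor -compmA /projl copy_delr compm1. Qed.

Lemma projr_pair (C : markovCategory) (A X Y : C) (f : hom A X) (g : hom A Y) :
  projr X Y ∘ ⟨f, g⟩ = g.
Proof. by rewrite !pairE compmA projr_tensor -compmA /projr copy_dell compm1. Qed.

(** Together with [pair_delr]: the inverse unitors are pairings with [del], a
    form in which they are visibly deterministic. *)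
Lemma pair_del (C : markovCategory) (A X : C) (f : hom A X) :
  ⟨del A, f⟩ = luniti X ∘ f.
Proof.
rewrite -[LHS]comp1m -lunitK -compmA; congr (_ ∘ _).
have -> : lunit X = projr unit_ob X.
  by rewrite /projr -(del_unique (idm _)) tensor1 compm1.
by rewrite projr_pair.
Qed.

(** I ⊗ I is isomorphic to I, hence terminal as well. *)
Lemma hom_unit2 (C : markovCategory) (A : C) (f g : hom A (unit_ob ⊗ unit_ob)) :
  f = g.
Proof.
rewrite -[f]comp1m -[g]comp1m -lunitK -!compmA.
by rewrite (del_unique (lunit _ ∘ f)) (del_unique (lunit _ ∘ g)).
Qed.

Lemma middle_swapE (C : symMonCategory) (X X' Y Y' : C) :
  middle_swap X X' Y Y' =
  associ X Y (X' ⊗ Y') ∘ (idm X ⊗₁ swap_head X' Y Y') ∘ assoc X X' (Y ⊗ Y').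
Proof. by rewrite /middle_swap /swap_head !idt_comp !compmA. Qed.

(** The only braiding involved is that of I with itself, which is the identity
    because I ⊗ I is terminal. *)
Lemma middle_swap_unit (C : markovCategory) (X Y : C) :
  middle_swap X unit_ob unit_ob Y = idm _.
Proof.
rewrite middle_swapE /swap_head (hom_unit2 (braid _ _) (idm _)) !tensor1 compm1.
by rewrite associK tensor1 compm1 assocK.
Qed.

Lemma middle_swap_nat (C : symMonCategory) (X X' Y Y' Z Z' W W' : C)
    (f : hom X Z) (f' : hom X' Z') (g : hom Y W) (g' : hom Y' W') :
  middle_swap Z Z' W W' ∘ ((f ⊗₁ f') ⊗₁ (g ⊗₁ g')) =
  ((f ⊗₁ g) ⊗₁ (f' ⊗₁ g')) ∘ middle_swap X X' Y Y'.
Proof.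
rewrite !middle_swapE -[LHS]compmA assoc_nat !compmA -associ_nat.
rewrite -(compmA _ _ (f ⊗₁ _)) -(compmA _ (f ⊗₁ _) (idm X ⊗₁ _)) -!tensorD.
by rewrite swap_head_nat comp1m compm1.
Qed.

Lemma middle_swap_pair (C : markovCategory) (A X X' Y Y' : C) (f : hom A X)
    (f' : hom A X') (g : hom A Y) (g' : hom A Y') :
  middle_swap X X' Y Y' ∘ ⟨⟨f, f'⟩, ⟨g, g'⟩⟩ = ⟨⟨f, g⟩, ⟨f', g'⟩⟩.
Proof.
rewrite /middle_swap -!compmA assoc_pair tensor_pair associ_pair tensor_pair.
by rewrite tensor_pair tensor_pair braid_pair assoc_pair !comp1m associ_pair.
Qed.

(** Naturality moves the two [del]s through the middle exchange in copy (X ⊗ Y),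
    whose middle factors become units, where it is the identity. *)
Lemma pair_proj (C : markovCategory) (X Y : C) :
  ⟨projl X Y, projr X Y⟩ = idm (X ⊗ Y).
Proof.
rewrite !pairE /projl /projr copy_tensor tensorD -compmA (compmA _ (middle_swap _ _ _ _)).
rewrite -middle_swap_nat middle_swap_unit comp1m -!tensorD !compmA.
by rewrite copy_delr copy_dell tensor1.
Qed.

Lemma det_pair (C : markovCategory) (A X Y : C) (f : hom A X) (g : hom A Y) :
  deterministic f -> deterministic g -> deterministic ⟨f, g⟩.
Proof.
move=> f_det g_det; rewrite /deterministic copy_tensor -compmA tensor_pair.
by rewrite f_det g_det -!pairE middle_swap_pair.
Qed.

Lemma copyE (C : markovCategory) (X : C) : copy X = ⟨idm X, idm X⟩.
Proof. by rewrite pairE tensor1 comp1m. Qed.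

Lemma det_comp (C : markovCategory) (X Y Z : C) (g : hom Y Z) (f : hom X Y) :
  deterministic g -> deterministic f -> deterministic (g ∘ f).
Proof.
by rewrite /deterministic => g_det f_det; rewrite compmA g_det -compmA f_det compmA tensorD.
Qed.

Lemma det_id (C : markovCategory) (X : C) : deterministic (idm X).
Proof. by rewrite /deterministic tensor1 comp1m compm1. Qed.

Lemma det_copy (C : markovCategory) (X : C) : deterministic (copy X).
Proof. by rewrite copyE; apply: det_pair; exact: det_id. Qed.

Lemma det_del (C : markovCategory) (X : C) : deterministic (del X).
Proof. exact: hom_unit2. Qed.

Lemma det_inv (C : markovCategory) (X Y : C) (f : hom X Y) (g : hom Y X) :
  g ∘ f = idm X -> f ∘ g = idm Y -> deterministic f -> deterministic g.
Proof.
move=> gf fg f_det; rewrite /deterministic -[LHS]comp1m -tensor1 -gf tensorD.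
by rewrite -!compmA (compmA (f ⊗₁ f)) -f_det -(compmA (copy Y)) fg compm1.
Qed.

Lemma pair_delr (C : markovCategory) (A X : C) (f : hom A X) :
  ⟨f, del A⟩ = runiti X ∘ f.
Proof.
rewrite -[LHS]comp1m -runitK -compmA; congr (_ ∘ _).
have -> : runit X = projl X unit_ob.
  by rewrite /projl -(del_unique (idm _)) tensor1 compm1.
by rewrite projl_pair.
Qed.

(** The inverse is the pairing of the identity with [del], both deterministic. *)
Lemma det_runit (C : markovCategory) (X : C) : deterministic (runit X).
Proof.
apply: det_inv (runitiK X) (runitK X) _.
rewrite -[runiti X]compm1 -pair_delr; apply: det_pair; [exact: det_id|exact: det_del].
Qed.

Lemma det_lunit (C : markovCategory) (X : C) : deterministic (lunit X).
Proof.
apply: det_inv (lunitiK X) (lunitK X) _.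
rewrite -[luniti X]compm1 -pair_del; apply: det_pair; [exact: det_del|exact: det_id].
Qed.

Lemma det_tensor (C : markovCategory) (X Y X' Y' : C) (f : hom X X')
    (g : hom Y Y') :
  deterministic f -> deterministic g -> deterministic (f ⊗₁ g).
Proof.
move=> f_det g_det; rewrite /deterministic !copy_tensor -[LHS]compmA -tensorD f_det g_det.
by rewrite tensorD compmA middle_swap_nat compmA.
Qed.

Lemma det_projl (C : markovCategory) (X Y : C) : deterministic (projl X Y).
Proof.
apply: det_comp; first exact: det_runit.
by apply: det_tensor; [exact: det_id | exact: det_del].
Qed.

Lemma det_projr (C : markovCategory) (X Y : C) : deterministic (projr X Y).
Proof.
apply: det_comp; first exact: det_lunit.
by apply: det_tensor; [exact: det_del | exact: det_id].
Qed.

(** A deterministic morphism into a tensor product is determined by its two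
    marginals; for a general morphism this fails, as the two components may be
    correlated. *)
Lemma det_pairE (C : markovCategory) (A X Y : C) (d : hom A (X ⊗ Y)) : deterministic d ->
  d = ⟨projl X Y ∘ d, projr X Y ∘ d⟩.
Proof. by move=> d_det; rewrite -pair_comp_det // pair_proj comp1m. Qed.

(** Equations between morphisms out of X ⊗ (Y ⊗ Z) can be checked on this
    nested pairing, on which the structural maps act by rearrangement. *)
Lemma pair_proj3 (C : markovCategory) (X Y Z : C) :
  ⟨projl X (Y ⊗ Z), ⟨projl Y Z ∘ projr X _, projr Y Z ∘ projr X _⟩⟩ = idm (X ⊗ (Y ⊗ Z)).
Proof. by rewrite -(det_pairE (@det_projr _ _ _)) pair_proj. Qed.

Lemma swap_head_pair (C : markovCategory) (A X Y Z : C) (f : hom A X)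
    (g : hom A Y) (h : hom A Z) :
  swap_head X Y Z ∘ ⟨f, ⟨g, h⟩⟩ = ⟨g, ⟨f, h⟩⟩.
Proof.
by rewrite /swap_head -!compmA associ_pair tensor_pair braid_pair comp1m assoc_pair.
Qed.

Lemma det_swap_head (C : markovCategory) (X Y Z : C) : deterministic (swap_head X Y Z).
Proof.
have pl := @det_projl; have pr := @det_projr.
rewrite -[swap_head _ _ _]compm1 -pair_proj3 swap_head_pair.
by repeat first [exact: pl | exact: pr | apply: det_pair | apply: det_comp].
Qed.

Lemma projr_swap_head (C : markovCategory) (X Y Z : C) :
  (idm Y ⊗₁ projr X Z) ∘ swap_head X Y Z = projr X (Y ⊗ Z).
Proof.
rewrite -[LHS]compm1 -pair_proj3 -compmA swap_head_pair tensor_pair comp1m projr_pair.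
by rewrite -(det_pairE (@det_projr _ _ _)).
Qed.

Lemma pair_tensor_projr (C : markovCategory) (X R Y Z : C) (a : hom R Y) (b : hom R Z) :
  ⟨idm X ⊗₁ a, b ∘ projr X R⟩ = associ X Y Z ∘ (idm X ⊗₁ ⟨a, b⟩).
Proof.
have -> : idm X ⊗₁ a = ⟨projl X R, a ∘ projr X R⟩.
  by rewrite -[LHS]compm1 -pair_proj tensor_pair comp1m.
rewrite -associ_pair -pair_comp_det; last exact: det_projr.
by rewrite -[in RHS](compm1 (_ ⊗₁ _)) -pair_proj tensor_pair comp1m.
Qed.

(** * Independence of disjoint groups of finitely many factors *)

Lemma det_pick_mor (C : markovCategory) K (X : K -> C) j s r (v : Defs.pick j s r) :
  deterministic (pick_mor X v).
Proof.
elim: v => {s r} [s|k s r v IHv] /=; first exact: det_id.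
by apply: det_comp; [exact: det_swap_head | apply: det_tensor => //; exact: det_id].
Qed.

Lemma det_select_mor (C : markovCategory) K K' (f : K -> K') (X : K' -> C) t s
    (w : select f t s) :
  deterministic (select_mor X w).
Proof.
elim: w => {t s} [s|i t s r v w IHw] /=; first exact: det_del.
by apply: det_comp; [apply: det_tensor => //; exact: det_id | exact: det_pick_mor].
Qed.

(** The joint distribution with conditionally independent components [q]: a
    morphism displays independence when it is the [prodm] of its marginals. *)
Definition prodm (C : markovCategory) K (X : K -> C) (A : C)
    (q : forall i, hom A (X i)) (s : seq K) : hom A (tens X s) :=
  tens_mor q s ∘ iter_copy A s.

Lemma prodm_cons (C : markovCategory) K (X : K -> C) (A : C)
    (q : forall i, hom A (X i)) i s :
  prodm q (i :: s) = ⟨q i, prodm q s⟩.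
Proof. by rewrite /prodm /= compmA -tensorD compm1 pairE. Qed.

Lemma pick_prodm (C : markovCategory) K (X : K -> C) (A : C)
    (q : forall i, hom A (X i)) j s r (v : Defs.pick j s r) :
  pick_mor X v ∘ prodm q s = ⟨q j, prodm q r⟩.
Proof.
elim: v => {s r} [s|k s r v IHv]; rewrite prodm_cons /=; first by rewrite comp1m.
by rewrite -compmA tensor_pair IHv swap_head_pair comp1m prodm_cons.
Qed.

Lemma pick_mem (K : eqType) (j k : K) s r :
  Defs.pick j s r -> k \in s -> k != j -> k \in r.
Proof.
elim=> {s r} [s|l s r _ IH]; rewrite !inE; first by case/orP => [->|].
by case/orP => [-> //|/IH H /H ->]; rewrite orbT.
Qed.

(** A selection that does not use the position of [j] may first discard the
    factor at that position.  The picks of [f i] and of [j] are exchanged by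
    [pick_swap]; since [s] has no repetition, the pick of [f i] so obtained is
    the one that [w] starts with. *)
Lemma select_avoid (C : markovCategory) K (K' : eqType) (f : K -> K')
    (X : K' -> C) j t s r (v : Defs.pick j s r) (w : select f t s) :
  uniq s -> j \notin map f t ->
  exists w' : select f t r,
    select_mor X w = select_mor X w' ∘ (projr (X j) (tens X r) ∘ pick_mor X v).
Proof.
move=> s_uniq; elim: w r v s_uniq => {t s} [s|i t s s1 v1 w IHw] r v s_uniq.
  by exists (select_nil _ r); apply/esym/del_unique.
rewrite /= inE negb_or => /andP[ji jt].
have ir : f i \in r by apply: (pick_mem v (pick_in v1)); rewrite eq_sym.
have [s1' [v1' [v' e]]] := pick_swap X v (pick_rem ir).
have eqv := pick_inj v1 s_uniq v1'.
dependent destruction eqv.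
have [w' ew] := IHw _ v' (pick_uniq v1' s_uniq) jt.
exists (select_cons (pick_rem ir) w') => /=.
rewrite ew (idt_comp _ (select_mor X w')) idt_comp -2!compmA -e.
rewrite -(compmA (swap_head _ _ _)) (compmA (idm _ ⊗₁ projr _ _)) projr_swap_head.
by rewrite (compmA (projr _ _) (idm _ ⊗₁ _)) projr_tensor !compmA.
Qed.

(** Selections of disjoint groups of positions from conditionally independent
    components are conditionally independent.  The induction moves the first
    factor selected by [w1] to the front; [w2] ignores it by [select_avoid], so
    the remaining copy acts on the other factors only. *)
Lemma select_pair_prodm (C : markovCategory) K1 K2 (K : eqType) (f : K1 -> K)
    (g : K2 -> K) (X : K -> C) (A : C) (q : forall i, hom A (X i)) t u s
    (w1 : select f t s) (w2 : select g u s) :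
  uniq s -> (forall i, i \in map f t -> i \notin map g u) ->
  ⟨select_mor X w1, select_mor X w2⟩ ∘ prodm q s =
  ⟨select_mor X w1 ∘ prodm q s, select_mor X w2 ∘ prodm q s⟩.
Proof.
elim: w1 w2 => {t s} [s|i t s r v w1 IHw] w2 s_uniq tu.
  by rewrite /= pair_del (del_unique (del _ ∘ _)) pair_del compmA.
have [w2' ->] := select_avoid X v w2 s_uniq (tu _ (mem_head _ _)).
have v_det := det_pick_mor X v.
rewrite /= (compmA _ (projr _ _)) -pair_comp_det //.
rewrite -!(compmA _ (pick_mor X v)) pick_prodm pair_tensor_projr.
rewrite -(compmA (associ _ _ _)) -(compmA _ (projr _ _)) projr_pair !tensor_pair IHw.
- by rewrite comp1m associ_pair.
- exact: pick_uniq v s_uniq.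
- by move=> k kt; apply: tu; rewrite inE kt orbT.
Qed.

(** * Kolmogorov products *)

Lemma det_reindex (C : markovCategory) (K K' : finType) (X : K' -> C) (f : K -> K')
    (f_inj : injective f) :
  deterministic (Defs.reindex X f_inj).
Proof. exact: det_select_mor. Qed.

Lemma reindex_pair_indep (C : markovCategory) (K1 K2 K : finType) (X : K -> C)
    (f : K1 -> K) (g : K2 -> K) (f_inj : injective f) (g_inj : injective g)
    (A : C) (p : hom A (bigtensor X)) :
  displays_indep_fin p -> (forall i j, f i != g j) ->
  ⟨Defs.reindex X f_inj, Defs.reindex X g_inj⟩ ∘ p =
  ⟨Defs.reindex X f_inj ∘ p, Defs.reindex X g_inj ∘ p⟩.
Proof.
move=> p_indep fg; rewrite p_indep; apply: select_pair_prodm; first exact: enum_uniq.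
by move=> _ /mapP[i _ ->]; apply/mapP => -[j _ /eqP]; rewrite (negbTE (fg i j)).
Qed.

(** Both marginals factor through the one on F ∪ G, where [reindex_pair_indep]
    applies; the factorization passes through the pairing because the marginal
    on F ∪ G is deterministic. *)
Lemma fin_marg_indep (C : markovCategory) (J : choiceType) (X : J -> C)
    (XJ : kolmogorovProduct X) (A : C) (p : hom A XJ) (F G : {fset J}) :
  displays_indep p -> [disjoint F & G]%fset ->
  ⟨@fin_marg _ _ _ XJ F, fin_marg G⟩ ∘ p = ⟨fin_marg F ∘ p, fin_marg G ∘ p⟩.
Proof.
move=> p_indep FG; have marg_U := proj1 (fin_marg_limit XJ).
rewrite -(marg_U _ _ (fsubsetUl F G)) -(marg_U _ _ (fsubsetUr F G)).
rewrite -pair_comp_det; last exact: kol_det.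
rewrite -!(compmA _ (fin_marg _)).
have FG_disj (i : F) (j : G) : fincl (fsubsetUl F G) i != fincl (fsubsetUr F G) j.
  apply/eqP => /(congr1 val) /= ij.
  by have /fdisjointP/(_ _ (valP i)) := FG; rewrite /= ij (valP j).
exact: (reindex_pair_indep (@fincl_inj _ _ _ _) (@fincl_inj _ _ _ _)
  (p_indep (F `|` G)%fset) FG_disj).
Qed.

Lemma fin_marg_tensor_inj (C : markovCategory) (J : choiceType) (X : J -> C)
    (XJ : infTensor X) (A Y : C) (a b : hom A (XJ ⊗ Y)) :
  (forall F, (fin_marg F ⊗₁ idm Y) ∘ a = (fin_marg F ⊗₁ idm Y) ∘ b) -> a = b.
Proof.
move=> ab; have [cone lim] := fin_marg_limit_tensor XJ Y.
have [|h [_ h_uniq]] := lim A (fun F => (fin_marg F ⊗₁ idm Y) ∘ a).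
  by move=> F F' sFF'; rewrite compmA cone.
by rewrite -(h_uniq a) // -(h_uniq b).
Qed.

(** The limit is preserved by - ⊗ Y, hence by Y ⊗ - through the braiding. *)
Lemma fin_marg_tensor2_inj (C : markovCategory) (J : choiceType) (X : J -> C)
    (XJ : infTensor X) (A : C) (a b : hom A (XJ ⊗ XJ)) :
  (forall F G, (fin_marg F ⊗₁ fin_marg G) ∘ a = (fin_marg F ⊗₁ fin_marg G) ∘ b) -> a = b.
Proof.
move=> ab; apply: fin_marg_tensor_inj => F.
rewrite -[LHS]comp1m -[RHS]comp1m -(braidK _ _) -!compmA; congr (_ ∘ _).
apply: fin_marg_tensor_inj => G; rewrite !compmA -!braid_nat.
by rewrite -!(compmA (braid _ _)) -!tensorD !comp1m !compm1 ab.
Qed.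

(** Both sides of the equation defining determinism of d are compared after
    marginalizing one copy to F and the other to G; there the claim is
    determinism of the marginal of d on F ∪ G. *)
Lemma kol_detP (C : markovCategory) (J : choiceType) (X : J -> C)
    (XJ : kolmogorovProduct X) (A : C) (d : hom A XJ) :
  (forall F, deterministic (fin_marg F ∘ d)) -> deterministic d.
Proof.
move=> d_det; apply: fin_marg_tensor2_inj => F G.
have marg_U := proj1 (fin_marg_limit XJ).
rewrite -(pairE d d) tensor_pair compmA -pairE.
rewrite -(marg_U _ _ (fsubsetUl F G)) -(marg_U _ _ (fsubsetUr F G)).
rewrite -pair_comp_det; last exact: kol_det.
by rewrite -!(compmA _ (fin_marg _)) -pair_comp_det.
Qed.

(** * Finite permutations and injections *)

Lemma finite_permutation_comp (J : Type) (sigma tau : J -> J) :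
  finite_permutation sigma -> finite_permutation tau ->
  finite_permutation (sigma \o tau).
Proof.
move=> [sigma_bij sigma_fin] [tau_bij tau_fin]; split; first exact: bij_comp.
apply: (@sub_finite_set _ _ ([set i | sigma i <> i] `|` [set i | tau i <> i])%classic).
  move=> i /= sti; have [ti|] := pselect (tau i = i); last by right.
  by left; move: sti; rewrite ti.
by rewrite finite_setU.
Qed.

Lemma finite_permutation_swap (J : eqType) (a b : J) :
  finite_permutation (fun i => if i == a then b else if i == b then a else i).
Proof.
split.
  apply: inv_bij => i; have [->|ia] := eqVneq i a.
    by rewrite eqxx; case: eqP.
  by have [->|ib] := eqVneq i b; rewrite ?eqxx // (negbTE ia) (negbTE ib).
apply: (@sub_finite_set _ _ [set a; b]%classic); last exact: finite_set2.
by move=> i /=; case: eqP => [|_]; [left|case: eqP => //; right].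
Qed.

(** On a finite list, an injection agrees with a finite permutation.  To treat
    one more point x, follow τ by the transposition of τ x and σ x: injectivity
    of τ and σ shows that it does not affect the points already treated. *)
Lemma finite_permutation_extend (J : eqType) (sigma : J -> J) (s : seq J) :
  injective sigma ->
  exists2 tau, finite_permutation tau & {in s, tau =1 sigma}.
Proof.
move=> sigma_inj; elim: s => [|x s [tau tau_fin tauE]].
  exists id => //; split; first by exists id.
  by apply: sub_finite_set (@finite_set0 J) => i; apply.
have [xs|xs] := boolP (x \in s).
  by exists tau => // i; rewrite inE => /orP[/eqP-> |]; exact: tauE.
have tau_inj := finite_permutation_inj tau_fin.
exists ((fun i => if i == tau x then sigma x else if i == sigma x then tau x else i) \o tau).
  exact: finite_permutation_comp (finite_permutation_swap _ _) tau_fin.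
move=> i /=; rewrite inE => /orP[/eqP->|si]; first by rewrite eqxx.
have ix : i != x by apply: contraNneq xs => <-.
by rewrite (inj_eq tau_inj) (negbTE ix) tauE // (inj_eq sigma_inj) (negbTE ix).
Qed.

(** Hilbert's hotel: take a sequence e without repetition outside F; send e k to
    e (2k + 1), the elements of F to terms of e with even index, and leave
    everything else in place. *)
Lemma injection_avoiding (J : choiceType) (F : {fset J}) :
  infinite_set [set: J]%classic ->
  exists2 sigma : J -> J, injective sigma & forall i, sigma i \notin F.
Proof.
move=> J_inf; have /infiniteP/card_leP[f] := infinite_setD J_inf (finite_fset F).
pose e k : J := val (f (to_setT k)).
have e_inj : injective e.
  by move=> k l /val_inj /(@inj _ _ _ f) H; have := H (in_setT _) (in_setT _) => /(congr1 val).
have e_avoid k : e k \notin F.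
  by have := valP (f (to_setT k)); rewrite inE => -[_ /negP].
pose sigma i := if i \in F then e (index i F).*2 else
  if pselect (exists k, e k = i) is left ek then e (sval (cid ek)).*2.+1 else i.
have sigmaP i : [\/ i \in F /\ sigma i = e (index i F).*2,
    exists2 k, e k = i & sigma i = e k.*2.+1 |
    (forall k, e k <> i) /\ sigma i = i /\ i \notin F].
  rewrite /sigma; have [iF|iF] := boolP (i \in F); first by constructor 1.
  case: pselect => [ek|ne]; last by constructor 3; split => // k ek; apply: ne; exists k.
  by constructor 2; exists (sval (cid ek)) => //; exact: (svalP (cid ek)).
exists sigma.
  move=> i j; have [[iF ->]|[k ki ->]|[ne [-> iF]]] := sigmaP i;
    have [[jF ->]|[l lj ->]|[ne' [-> jF]]] := sigmaP j.
  - by move=> /e_inj/double_inj; exact: index_inj.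
  - by move=> /e_inj /(congr1 odd) /=; rewrite !odd_double.
  - by move=> /ne'.
  - by move=> /e_inj /(congr1 odd) /=; rewrite !odd_double.
  - by move=> /e_inj [] /double_inj kl; rewrite -ki -lj kl.
  - by move=> /ne'.
  - by move=> /esym/ne.
  - by move=> /esym/ne.
  - by [].
move=> i; have [[_ ->]|[k _ ->]|[_ [-> //]]] := sigmaP i; exact: e_avoid.
Qed.

(** * Action of injections on a Kolmogorov power *)

Lemma fin_marg_hat (C : markovCategory) (X : C) (J : choiceType)
    (XJ : infTensor (fun _ : J => X)) (sigma tau : J -> J)
    (sigma_inj : injective sigma) (tau_inj : injective tau) (F : {fset J}) :
  {in F, sigma =1 tau} ->
  fin_marg F ∘ hat XJ sigma_inj = fin_marg F ∘ hat XJ tau_inj.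
Proof.
move=> st; have imE : (sigma @` F = tau @` F)%fset by apply: eq_in_imfset.
have sF : (sigma @` F `<=` tau @` F)%fset by rewrite imE.
rewrite !hatE -(proj1 (fin_marg_limit XJ) _ _ sF) compmA; congr (_ ∘ _).
rewrite /relabel /marg (reindex_const_comp X _ _ (@fin_image_inj _ _ F tau_inj)) // => i.
by apply: val_inj; rewrite /= st // (valP i).
Qed.

Lemma det_hat (C : markovCategory) (X : C) (J : choiceType)
    (XJ : kolmogorovPower X J) (sigma : J -> J) (sigma_inj : injective sigma) :
  deterministic (hat XJ sigma_inj).
Proof.
apply: kol_detP => F; rewrite hatE.
by apply: det_comp; [exact: det_reindex | exact: kol_det].
Qed.

(** The coordinates of σ^ are those with index in the image of σ, all outside
    F. *)
Lemma fin_marg_hat_indep (C : markovCategory) (X : C) (J : choiceType)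
    (XJ : kolmogorovPower X J) (A : C) (p : hom A XJ) (sigma : J -> J)
    (sigma_inj : injective sigma) (F : {fset J}) :
  displays_indep p -> (forall i, sigma i \notin F) ->
  ⟨hat XJ sigma_inj, fin_marg F⟩ ∘ p = ⟨hat XJ sigma_inj ∘ p, fin_marg F ∘ p⟩.
Proof.
move=> p_indep sF; apply: fin_marg_tensor_inj => G.
rewrite compmA !tensor_pair !compmA !comp1m hatE.
have -> (B : C) (f : hom B _) (g : hom B _) : ⟨relabel X sigma_inj G ∘ f, g⟩ =
    (relabel X sigma_inj G ⊗₁ idm (fin_tensor (fun _ : J => X) F)) ∘ ⟨f, g⟩.
  by rewrite tensor_pair comp1m.
rewrite -(compmA _ _ p) fin_marg_indep //; first by rewrite tensor_pair compmA comp1m.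
by apply/fdisjointP => _ /imfsetP[i _ ->].
Qed.

(** The joint law of the whole family with s is invariant under finite
    permutations; as it is determined by its marginals on X_F ⊗ T, it is then
    invariant under every injection, by [finite_permutation_extend]. *)
Lemma hat_exchangeable (C : markovCategory) (X : C) (J : choiceType)
    (XJ : kolmogorovPower X J) (A T : C) (p : hom A XJ) (s : hom XJ T)
    (perm_inv : forall (sigma : J -> J) (sigma_fin : finite_permutation sigma),
      hat XJ (finite_permutation_inj sigma_fin) ∘ p = p /\
      s ∘ hat XJ (finite_permutation_inj sigma_fin) = s)
    (sigma : J -> J) (sigma_inj : injective sigma) :
  ⟨hat XJ sigma_inj, s⟩ ∘ p = ⟨idm XJ, s⟩ ∘ p.
Proof.
apply: fin_marg_tensor_inj => F.
have [tau tau_fin tauE] := finite_permutation_extend F sigma_inj.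
have [taup stau] := perm_inv _ tau_fin.
rewrite compmA tensor_pair (fin_marg_hat XJ sigma_inj (finite_permutation_inj tau_fin)).
  rewrite -tensor_pair -(compmA _ _ p) -{1}stau.
  rewrite -{1}[hat _ _]comp1m -pair_comp_det; last exact: det_hat.
  by rewrite -[in LHS](compmA _ _ p) taup.
by move=> i iF; rewrite tauE.
Qed.

(** * The zero-one law *)

(** If the pair (t, s) is concentrated on the diagonal of T ⊗ T, then t and s are
    almost surely equal.  Causality is applied to ⟨t, s⟩ followed by one of the two
    projections: on the diagonal the projections agree, hence they agree jointly
    with the input of ⟨t, s⟩. *)
Lemma causal_ae_eq (C : markovCategory) (C_causal : causal C) (A X T : C)
    (p : hom A X) (s t : hom X T) :
  ⟨t, s⟩ ∘ p = copy T ∘ (s ∘ p) -> ⟨t, idm X⟩ ∘ p = ⟨s, idm X⟩ ∘ p.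
Proof.
move=> tsp.
have : ⟨projl T T, idm _⟩ ∘ (⟨t, s⟩ ∘ p) = ⟨projr T T, idm _⟩ ∘ (⟨t, s⟩ ∘ p).
  rewrite tsp !(compmA _ (copy T)) !(pair_comp_det _ _ (@det_copy _ _)).
  by rewrite copyE projl_pair projr_pair.
rewrite !pairE => /C_causal; rewrite -!(pairE _ (idm (T ⊗ T))) -(pairE t s).
(* Discard the copy of T ⊗ T that causality keeps beside T and X. *)
move=> /(congr1 (compm (projl T (T ⊗ T) ⊗₁ idm X))).
rewrite -!(compmA _ (copy X)) !(compmA (projl _ _ ⊗₁ _)).
have proj_h (h : hom (T ⊗ T) T) :
    (projl T (T ⊗ T) ⊗₁ idm X) ∘ ((⟨h, idm _⟩ ∘ ⟨t, s⟩) ⊗₁ idm X) = (h ∘ ⟨t, s⟩) ⊗₁ idm X.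
  by rewrite -tensorD compmA projl_pair comp1m.
rewrite !proj_h projl_pair projr_pair.
by rewrite !(compmA _ (copy X)) -!pairE.
Qed.

Theorem theorem5p4 (C : markovCategory) (C_causal : causal C)
  (X : C) (J : choiceType) (J_infinite : infinite_set [set: J]%classic)
  (XJ : kolmogorovPower X J) (A T : C) (p : hom A XJ) (s : hom XJ T)
  (s_det : deterministic s)
  (p_indep : displays_indep p)
  (perm_inv : forall (sigma : J -> J) (sigma_fin : finite_permutation sigma),
     hat XJ (finite_permutation_inj sigma_fin) ∘ p = p /\
     s ∘ hat XJ (finite_permutation_inj sigma_fin) = s) :
  deterministic (s ∘ p).
Proof.
have joint_inv sigma sigma_inj := hat_exchangeable perm_inv (sigma := sigma) sigma_inj.
have hat_inv sigma (sigma_inj : injective sigma) : hat XJ sigma_inj ∘ p = p.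
  have := congr1 (compm (projl XJ T)) (joint_inv _ sigma_inj).
  by rewrite !(compmA (projl _ _)) !projl_pair comp1m.
have s_ae_inv sigma (sigma_inj : injective sigma) :
    ⟨s ∘ hat XJ sigma_inj, idm XJ⟩ ∘ p = ⟨s, idm XJ⟩ ∘ p.
  apply: causal_ae_eq => //.
  have := congr1 (compm (s ⊗₁ idm T)) (joint_inv _ sigma_inj).
  rewrite !(compmA (s ⊗₁ _)) !tensor_pair comp1m compm1 => ->.
  by rewrite compmA s_det pairE.
have ps_indep : ⟨idm XJ, s⟩ ∘ p = ⟨p, s ∘ p⟩.
  apply: fin_marg_tensor_inj => F.
  have [sigma sigma_inj sF] := injection_avoiding F J_infinite.
  rewrite compmA !tensor_pair compm1 comp1m.
  have := fin_marg_hat_indep sigma_inj p_indep sF.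
  move/(congr1 (compm (s ⊗₁ idm _))).
  rewrite tensor_pair hat_inv comp1m compmA tensor_pair comp1m.
  have := congr1 (compm (idm T ⊗₁ fin_marg F)) (s_ae_inv _ sigma_inj).
  rewrite !(compmA (_ ⊗₁ _)) !tensor_pair !comp1m compm1 => -> /(congr1 (compm (braid _ _))).
  by rewrite compmA !braid_pair.
have := congr1 (compm (s ⊗₁ idm T)) ps_indep.
rewrite compmA !tensor_pair compm1 !comp1m => ss_indep.
by rewrite /deterministic compmA s_det -!pairE.
Qed.
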